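(* Let $N\ge 1$ and $m\ge 1$ be integers, and let $u:\mathbb{R}^N\to\mathbb{R}$ be a classical solution of $\Delta^{2m}u=e^u$ in $\mathbb{R}^N$. Then $\Delta^{2m-1}u<0$ everywhere in $\mathbb{R}^N$, i.e. $(-\Delta)^{2m-1}u>0$ in $\mathbb{R}^N$.
   Context: A classical (or smooth) solution of $\Delta^{\ell}u=f(u)$, with $\ell$ a positive integer, is a solution of class $C^{2\ell}$; here $u\in C^{4m}(\mathbb{R}^N)$ and the equation holds pointwise. $\Delta$ is the Laplacian on $\mathbb{R}^N$ and $\Delta^k$ its $k$-th iterate. *)

(* Defs.v *)
From HB Require Import structures.
From mathcomp Require Import all_boot all_order all_algebra.
From mathcomp Require Import all_classical all_reals all_analysis.
Set Implicit Arguments.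
Unset Strict Implicit.
Unset Printing Implicit Defensive.
Import Order.TTheory GRing.Theory Num.Theory.
Import numFieldNormedType.Exports.
Local Open Scope ring_scope.
Local Open Scope classical_set_scope.

Definition basis_vec (R : realType) (N : nat) (i : 'I_N) : 'rV[R]_N :=
  delta_mx 0 i.

(* The norm on 'rV[R]_N is the sup norm; it induces the Euclidean topology, so
   continuity and partial derivatives have their usual meaning. *)
Definition partial_deriv (R : realType) (N : nat) (i : 'I_N)
    (u : 'rV[R]_N -> R) : 'rV[R]_N -> R :=
  fun x => 'D_(basis_vec R i) u x.

Fixpoint class_C (R : realType) (N k : nat) (u : 'rV[R]_N -> R) : Prop :=
  match k with
  | 0 => continuous u
  | k'.+1 => continuous u /\
      forall i : 'I_N,
        (forall x, derivable u x (basis_vec R i)) /\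
        class_C k' (partial_deriv i u)
  end.

Definition laplacian (R : realType) (N : nat) (u : 'rV[R]_N -> R) :
    'rV[R]_N -> R :=
  fun x => \sum_(i < N) partial_deriv i (partial_deriv i u) x.

Definition iter_laplacian (R : realType) (N k : nat) (u : 'rV[R]_N -> R) :
    'rV[R]_N -> R :=
  iter k (@laplacian R N) u.

Definition iter_neg_laplacian (R : realType) (N k : nat)
    (u : 'rV[R]_N -> R) : 'rV[R]_N -> R :=
  iter k (fun v : 'rV[R]_N -> R => fun x => - laplacian v x) u.

Definition classical_solution (R : realType) (N l : nat) (f : R -> R)
    (u : 'rV[R]_N -> R) : Prop :=
  class_C (2 * l)%N u /\ forall x, iter_laplacian l u x = f (u x).

(* Main.v *)
Require Import Defs.
From HB Require Import structures.
From mathcomp Require Import all_boot all_order all_algebra.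
From mathcomp Require Import all_classical all_reals all_analysis.
From mathcomp Require Import ring lra zify.
Import Order.TTheory GRing.Theory Num.Theory.
Import numFieldNormedType.Exports.
Local Open Scope ring_scope.
Local Open Scope classical_set_scope.
Set Implicit Arguments.
Unset Strict Implicit.
Unset Printing Implicit Defensive.

(** Suppose that Delta^(L-1) u >= 0 at some point a, where L = 2m.  The classical
    argument replaces u by its spherical means about a, which turns the equation
    into a radial differential inequality whose solutions blow up at a finite
    radius.  The proof keeps this scheme but uses smoother means, for which no
    surface integral is needed: M_p v (r) is the average of v for the weight
    (r - |x - a|^2)_+^p, so that r is the square of a radius.

    For p >= 2 this weight is C^1 and its partial derivatives have the form
    polynomial times (r - |x - a|^2)_+^(p-1).  Differentiating under the integral
    in r and integrating by parts twice in x gives (is_derive_mean)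
      d/dr M_p v = M_(p+1) (Delta v) / (4 (p + 1) + 2 N).
    Thus, up to positive factors, the successive derivatives of r |-> M_2 u are the
    means of Delta u, Delta^2 u, ..., and the L-th one is M_(L+2) (exp u).  Write
    A_j for the j-th derivative of M_2 u on (0, +oo).

    The sign hypothesis at a and exp u > 0 make A_(L-1) positive (mean_gt0), so A_0
    and the lower derivatives tend to +oo.  By Jensen's inequality and a comparison
    of the weights for two radii (mean_jensen, mean_delay),
      A_L(r) >= C ((r - s) / r)^L exp (A_0(s))   for s <= r <= 2 s.
    Iterating this along r_n = r_0 (2 - 2^-n) makes A_0(r_n) grow without bound
    although r_n stays below 2 r_0, a contradiction (ode_blowup).  Since the
    (2m-1)-st power of -Delta is minus that of Delta, both forms of the claim follow.

    All that is used of the integral over R^N is that it is linear, positive,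
    nonzero on a cube, and zero on partial derivatives of C^1 functions with bounded
    support.  A limit of Riemann sums along an ultrafilter on the mesh parameter has
    these properties: the limit exists as soon as the sums are bounded, linearity and
    positivity pass to the limit, and sums of difference quotients telescope. *)

(** * The integral as an ultralimit of Riemann sums *)

(** The mesh is 1/t and the grid covers [-t, t)^N: letting the grid grow with t makes the
    limit independent of any a priori bound on the supports. *)
Definition node (R : realType) (N t : nat) (k : {ffun 'I_N -> 'I_(2 * t ^ 2)}) :
    'rV[R]_N :=
  \row_i ((k i)%:R / t%:R - t%:R).

(** Half-open, so that the grid of mesh 1/t has exactly (2 K t)^N points in it when
    K <= t. *)
Definition cube (R : realType) (N K : nat) (x : 'rV[R]_N) : bool :=
  [forall i, - K%:R <= x 0 i < K%:R].

Definition riemann_sum (R : realType) (N t : nat) (f : 'rV[R]_N -> R) : R :=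
  t%:R ^- N * \sum_(k : {ffun 'I_N -> 'I_(2 * t ^ 2)}) f (node R k).

Lemma card_ord_itv (n a b : nat) : (a <= b)%N -> (b <= n)%N ->
  #|[pred j : 'I_n | (a <= j < b)%N]| = (b - a)%N.
Proof.
move=> ab bn; rewrite -sum1_card.
rewrite -(big_mkord (fun j => (a <= j < b)%N) (fun=> 1%N)).
rewrite -[RHS]muln1 -sum_nat_const_nat.
rewrite (big_cat_nat (leq0n a)) ?(leq_trans ab)//=.
rewrite (@big_cat_nat _ _ _ b a n)//= [X in (X + _)%N]big_nat_cond big1 ?add0n; last first.
  by move=> j /andP[/andP[_ ja] /andP[aj _]]; move: (leq_trans ja aj); rewrite ltnn.
rewrite [X in (_ + X)%N]big_nat_cond [X in (_ + X)%N]big1 ?addn0; last first.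
  by move=> j /andP[/andP[bj _] /andP[_ jb]]; move: (leq_trans jb bj); rewrite ltnn.
rewrite big_nat_cond [RHS]big_nat_cond; apply: eq_bigl => j.
by rewrite andbT andbb.
Qed.

Lemma cube_node (R : realType) (N t K : nat) (k : {ffun 'I_N -> 'I_(2 * t ^ 2)}) :
  (0 < t)%N -> (K <= t)%N ->
  cube K (node R k) =
  (k \in ffun_on [pred j : 'I_(2 * t ^ 2) | (t * (t - K) <= j < t * (t + K))%N]).
Proof.
move=> t0 Kt; apply/forallP/ffun_onP => H i; have := H i;
  rewrite !inE !mxE; have t0' : 0 < t%:R :> R by rewrite ltr0n.
- rewrite lerBrDl ltrBlDr ler_pdivlMr// ltr_pdivrMr//.
  by rewrite -natrB// -natrD -!natrM ler_nat ltr_nat mulnC [X in _ && (_ < X)%N]mulnC addnC.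
- rewrite lerBrDl ltrBlDr ler_pdivlMr// ltr_pdivrMr//.
  by rewrite -natrB// -natrD -!natrM ler_nat ltr_nat mulnC [X in _ && (_ < X)%N]mulnC addnC.
Qed.

Lemma riemann_sum_cube (R : realType) (N t K : nat) : (0 < t)%N -> (K <= t)%N ->
  riemann_sum t (fun x : 'rV[R]_N => (cube K x)%:R) = (2 * K)%:R ^+ N.
Proof.
move=> t0 Kt; rewrite /riemann_sum.
under eq_bigr do rewrite cube_node//.
rewrite -natr_sum -big_mkcond /= sum1_card card_ffun_on card_ord card_ord_itv; last 2 first.
- by rewrite leq_mul2l; apply/orP; right; lia.
- by rewrite -mulnn mulnCA leq_mul2l; apply/orP; right; lia.
rewrite natrX -exprVn -exprMn; congr (_ ^+ _).
have -> : (t * (t + K) - t * (t - K) = t * (2 * K))%N by rewrite -mulnBr; congr (_ * _)%N; lia.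
by rewrite natrM mulKf// pnatr_eq0; lia.
Qed.

Definition supported (R : realType) (N : nat) (f : 'rV[R]_N -> R) : Prop :=
  exists (K : nat) (B : R), forall x, `|f x| <= B * (cube K x)%:R.

Lemma riemann_sum_linear (R : realType) (N t : nat) (a : R) (f g : 'rV[R]_N -> R) :
  riemann_sum t (fun x => a * f x + g x) =
  a * riemann_sum t f + riemann_sum t g.
Proof. by rewrite /riemann_sum big_split/= -mulr_sumr; ring. Qed.

Lemma normr_riemann_sum (R : realType) (N t K : nat) (B : R) (f : 'rV[R]_N -> R) :
  (0 < t)%N -> (K <= t)%N -> (forall x, `|f x| <= B * (cube K x)%:R) ->
  `|riemann_sum t f| <= B * (2 * K)%:R ^+ N.
Proof.
move=> t0 Kt fB; rewrite -(riemann_sum_cube R N t0 Kt).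
rewrite /riemann_sum normrM ger0_norm ?invr_ge0 ?exprn_ge0// mulrCA.
rewrite ler_wpM2l ?invr_ge0 ?exprn_ge0// mulr_sumr.
by apply: (le_trans (ler_norm_sum _ _ _)); apply: ler_sum => k _; exact: fB.
Qed.

(** Along an ultrafilter every bounded sequence converges, so that the limit of Riemann sums is
    additive on all bounded functions with bounded support, continuous or not. *)
Definition grid_filter : set_system nat :=
  sval (cid (ultraFilterLemma eventually_filter)).

Instance grid_filter_ultra : UltraFilter grid_filter.
Proof. by have [] := svalP (cid (ultraFilterLemma eventually_filter)). Qed.

Lemma grid_filter_eventually (A : set nat) : \oo A -> grid_filter A.
Proof. by have [_] := svalP (cid (ultraFilterLemma eventually_filter)); apply. Qed.

Definition grid_integral (R : realType) (N : nat) (f : 'rV[R]_N -> R) : R :=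
  lim ((fun t => riemann_sum t f) @ grid_filter).

Lemma near_grid (P : nat -> Prop) n0 : (forall t, (n0 <= t)%N -> P t) ->
  \forall t \near grid_filter, P t.
Proof. by move=> H; apply: grid_filter_eventually; exists n0. Qed.

(** The sums eventually stay in a compact interval, so they cluster somewhere along the
    ultrafilter, and along an ultrafilter a cluster point is a limit. *)
Lemma cvg_riemann_sum (R : realType) (N : nat) (f : 'rV[R]_N -> R) :
  supported f ->
  (fun t => riemann_sum t f) @ grid_filter --> grid_integral f.
Proof.
move=> [K [B fB]].
pose C := B * (2 * K)%:R ^+ N.
have [p [_ pcl]] : (`[- C, C] `&` cluster ((fun t => riemann_sum t f) @ grid_filter)) !=set0.
  apply: segment_compact; apply: (@near_grid _ (maxn 1 K)) => t.
  rewrite geq_max => /andP[t0 Kt].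
  by rewrite /= in_itv/= -ler_norml; exact: normr_riemann_sum.
apply/cvg_ex; exists p => V pV.
have [//|nV] := in_ultra_setVsetC ((fun t => riemann_sum t f) @^-1` V) grid_filter_ultra.
by have [x []] := pcl (~` V) V nV pV.
Qed.

Lemma grid_integral_linear (R : realType) (N : nat) (a : R) (f g : 'rV[R]_N -> R) :
  supported f -> supported g ->
  grid_integral (fun x => a * f x + g x) = a * grid_integral f + grid_integral g.
Proof.
move=> sf sg; apply: (@cvg_lim _ _ _ grid_filter) => //.
under eq_fun do rewrite riemann_sum_linear.
by apply: cvgD; [apply: cvgM; [exact: cvg_cst|]|]; exact: cvg_riemann_sum.
Qed.

Lemma grid_integral_ge0 (R : realType) (N : nat) (f : 'rV[R]_N -> R) :
  supported f -> (forall x, 0 <= f x) -> 0 <= grid_integral f.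
Proof.
move=> sf f0; apply: (cvgr_to_ge (cvg_riemann_sum sf)).
apply: nearW => t; apply: mulr_ge0; first by rewrite invr_ge0 exprn_ge0.
exact: sumr_ge0.
Qed.

Lemma supported_cube (R : realType) (N K : nat) :
  supported (fun x : 'rV[R]_N => (cube K x)%:R).
Proof. by exists K, 1 => x; rewrite mul1r ger0_norm. Qed.

Lemma grid_integral_cube (R : realType) (N K : nat) :
  grid_integral (fun x : 'rV[R]_N => (cube K x)%:R) = (2 * K)%:R ^+ N.
Proof.
apply: (@cvg_lim _ _ _ grid_filter) => //; apply: cvg_near_cst.
apply: (@near_grid _ (maxn 1 K)) => t; rewrite geq_max => /andP[t0 Kt].
exact: riemann_sum_cube.
Qed.

(** * The integral of a partial derivative vanishes *)

(** Reduces directional derivatives to one variable, where the mean value theorem applies. *)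
Lemma is_derive_line (R : realType) (N : nat) (g : 'rV[R]_N -> R) (x v : 'rV[R]_N) (s : R) :
  derivable g (x + s *: v) v ->
  is_derive s 1 (fun r : R => g (x + r *: v)) ('D_v g (x + s *: v)).
Proof.
have E : (fun h : R => h^-1 *: (((fun r : R => g (x + r *: v)) \o shift s) (h *: 1)
                                - g (x + s *: v)))
   = (fun h => h^-1 *: ((g \o shift (x + s *: v)) (h *: v) - g (x + s *: v))).
  apply/funext => h /=; rewrite scaler1 /=; congr (_ *: (g _ - _)).
  by rewrite scalerDl addrCA addrA.
move=> dg; split; first by rewrite /derivable E.
by rewrite /derive E.
Qed.

Lemma cube_le (R : realType) (N K L : nat) (x : 'rV[R]_N) : (K <= L)%N -> cube K x -> cube L x.
Proof.
move=> KL /forallP xK; apply/forallP => i; have /andP[a b] := xK i.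
by apply/andP; split; [apply: le_trans a|apply: lt_le_trans b _]; rewrite ?lerN2 ler_nat.
Qed.

Lemma supported_linear (R : realType) (N : nat) (k : R) (f g : 'rV[R]_N -> R) :
  supported f -> supported g -> supported (fun x => k * f x + g x).
Proof.
have widen (K L : nat) (B : R) (x : 'rV[R]_N) : (K <= L)%N ->
    B * (cube K x)%:R <= `|B| * (cube L x)%:R.
  move=> KL; apply: (@le_trans _ _ (`|B| * (cube K x)%:R)).
    by rewrite ler_wpM2r ?ler0n// ler_norm.
  by rewrite ler_wpM2l// ler_nat; case: (boolP (cube K x)) => // /(cube_le KL) ->.
move=> [K [B fB]] [L [C gC]]; exists (maxn K L), (`|k| * `|B| + `|C|) => x.
rewrite [leRHS]mulrDl; apply: (le_trans (ler_normD _ _)); apply: lerD.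
- rewrite normrM -mulrA ler_wpM2l// (le_trans (fB x))//.
  by apply: widen; rewrite leq_maxl.
- by rewrite (le_trans (gC x))//; apply: widen; rewrite leq_maxr.
Qed.

Lemma compact_cube (R : realType) (N K : nat) :
  compact [set x : 'rV[R]_N | forall i, `[- K%:R, K%:R]%classic (x ord0 i)].
Proof.
exact: (@rV_compact R N (fun=> `[- K%:R, K%:R]%classic) (fun=> @segment_compact _ _ _)).
Qed.

Lemma cube_closed_cube (R : realType) (N K : nat) (x : 'rV[R]_N) : cube K x ->
  forall i, `[- K%:R, K%:R]%classic (x ord0 i).
Proof. by move=> /forallP xK i; rewrite /= in_itv/=; case/andP: (xK i) => -> /ltW. Qed.

Lemma bounded_on_cube (R : realType) (N K : nat) (f : 'rV[R]_N -> R) :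
  continuous f -> exists2 B : R, 0 <= B & forall x, cube K x -> `|f x| <= B.
Proof.
move=> cf.
have : compact (f @` [set x : 'rV[R]_N | forall i, `[- K%:R, K%:R]%classic (x ord0 i)]).
  exact: (continuous_compact (continuous_subspaceT cf) (@compact_cube R N K)).
move=> /compact_bounded[M [_ /(_ (`|M| + 1))]].
rewrite (le_lt_trans (ler_norm M)) ?ltrDl// => /(_ isT) fM.
exists (`|M| + 1) => [|x xK]; first exact: addr_ge0.
by apply: fM; exists x => //; exact: cube_closed_cube.
Qed.

Lemma supported_continuous (R : realType) (N K : nat) (f : 'rV[R]_N -> R) :
  continuous f -> (forall x, ~~ cube K x -> f x = 0) -> supported f.
Proof.
move=> cf f0; have [B B0 fB] := bounded_on_cube K cf.
exists K, B => x; have [/fB|/f0 ->] := boolP (cube K x); first by rewrite mulr1.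
by rewrite normr0 mulr0.
Qed.

Lemma unif_continuous_line (R : realType) (N K : nat) (f : 'rV[R]_N -> R) (v : 'rV[R]_N) (e : R) :
  continuous f -> 0 < e ->
  \forall s \near nbhs (0 : R), forall x, cube K x -> `|f (x + s *: v) - f x| <= e.
Proof.
move=> cf e0; have := @compact_cube R N K; rewrite compact_near_coveringP.
move=> /(_ R (nbhs (0 : R)) (fun s x => `|f (x + s *: v) - f x| <= e)) H.
near=> s => x /cube_closed_cube; move: x; near: s; apply: H => x _.
have cF : {for (x, 0 : R), continuous (fun z : 'rV[R]_N * R => f (z.1 + z.2 *: v) - f z.1)}.
  apply: cvgB; last by apply: continuous_comp; [exact: cvg_fst|exact: cf].
  apply: (@continuous_comp _ _ _ (fun z : 'rV[R]_N * R => z.1 + z.2 *: v) f); last exact: cf.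
  by apply: cvgD; [exact: cvg_fst|apply: cvgZr_tmp; exact: cvg_snd].
move/cvgrPdist_le : cF => /(_ _ e0); rewrite /= scale0r addr0 subrr.
by under eq_near do rewrite sub0r normrN.
Unshelve. all: by end_near. Qed.

(** Translation of the grid by one step in direction i, made cyclic so as to be a bijection. *)
Definition shift_index (N t : nat) (i : 'I_N) (k : {ffun 'I_N -> 'I_(2 * t ^ 2)}) :
    {ffun 'I_N -> 'I_(2 * t ^ 2)} :=
  [ffun j => if j == i then ordS (k j) else k j].

Lemma shift_index_bij (N t : nat) (i : 'I_N) : bijective (@shift_index N t i).
Proof.
exists (fun k : {ffun 'I_N -> 'I_(2 * t ^ 2)} =>
  [ffun j => if j == i then ord_pred (k j) else k j]).
- by move=> k; apply/ffunP => j; rewrite !ffunE; case: (j == i); rewrite ?ordSK.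
- by move=> k; apply/ffunP => j; rewrite !ffunE; case: (j == i); rewrite ?ord_predK.
Qed.

(** The cyclic shift disagrees with a translation only on the last layer of the grid; there
    the translated point and the wrapped point both lie outside the support of g. *)
Lemma node_shift (R : realType) (N t K : nat) (i : 'I_N) (g : 'rV[R]_N -> R)
    (k : {ffun 'I_N -> 'I_(2 * t ^ 2)}) :
  (K < t)%N -> (forall x, ~~ cube K x -> g x = 0) ->
  g (node R k + t%:R^-1 *: basis_vec R i) = g (node R (shift_index i k)).
Proof.
move=> Kt g0; have t0 : t%:R != 0 :> R by rewrite pnatr_eq0; lia.
have Kt' : K%:R < t%:R :> R by rewrite ltr_nat.
have [klt|kge] := ltnP (k i).+1 (2 * t ^ 2).
  congr g; apply/rowP => j; rewrite !mxE ffunE eqxx /=.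
  case: eqP => [->|_]; last by rewrite mulr0 addr0.
  by rewrite mulr1 /= modn_small// -[in RHS]natr1; field.
have kE : ((k i).+1 = 2 * t ^ 2)%N by apply/eqP; rewrite eqn_leq kge andbT; exact: ltn_ord.
rewrite !g0//; apply/negP => /forallP /(_ i); rewrite !mxE ?ffunE eqxx /=.
- rewrite kE modnn mul0r sub0r => /andP[]; lra.
- have -> : (k i)%:R = 2 * t%:R ^+ 2 - 1 :> R.
    have := congr1 (fun n => n%:R : R) kE.
    by rewrite natrM natrX -natr1 => <-; rewrite addrK.
  have -> : (2 * t%:R ^+ 2 - 1) / t%:R - t%:R + t%:R^-1 * (i == i)%:R = t%:R :> R.
    by rewrite eqxx /=; field.
  by move=> /andP[_]; lra.
Qed.

Lemma riemann_sum_shift (R : realType) (N t K : nat) (i : 'I_N) (g : 'rV[R]_N -> R) :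
  (K < t)%N -> (forall x, ~~ cube K x -> g x = 0) ->
  riemann_sum t (fun x => g (x + t%:R^-1 *: basis_vec R i)) = riemann_sum t g.
Proof.
move=> Kt g0; rewrite /riemann_sum; congr (_ * _).
rewrite [RHS](reindex (@shift_index N t i)) /=; last exact/onW_bij/shift_index_bij.
by apply: eq_bigr => k _; exact: (node_shift _ _ Kt g0).
Qed.

Lemma continuous_coord_out (R : realType) (N K : nat) (x : 'rV[R]_N) : ~~ cube K.+1 x ->
  \forall y \near x, ~~ cube K y.
Proof.
rewrite negb_forall => /existsP[i]; rewrite negb_and -ltNge -leNgt => /orP xi.
have ci := @coord_continuous R 1 N ord0 i x.
have [xi'|xi'] : x ord0 i < - K%:R \/ K%:R < x ord0 i.
- by case: xi => xi; [left|right]; [apply: lt_trans xi _|apply: lt_le_trans xi];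
    rewrite ?ltrN2 ltr_nat.
- have : \forall y \near x, (y : 'rV[R]_N) ord0 i < - K%:R by exact: (cvgr_lt (x ord0 i) ci).
  apply: filterS => y yi; apply/negP => /forallP/(_ i)/andP[]; lra.
- have : \forall y \near x, K%:R < (y : 'rV[R]_N) ord0 i by exact: (cvgr_gt (x ord0 i) ci).
  apply: filterS => y yi; apply/negP => /forallP/(_ i)/andP[]; lra.
Qed.

Lemma partial_deriv_out (R : realType) (N K : nat) (i : 'I_N) (g : 'rV[R]_N -> R) (x : 'rV[R]_N) :
  (forall x, ~~ cube K x -> g x = 0) -> ~~ cube K.+1 x -> partial_deriv i g x = 0.
Proof.
move=> g0 xK; rewrite /partial_deriv (@near_eq_derive _ _ _ _ (cst 0)) ?derive_cst//.
by apply: filterS (continuous_coord_out xK) => y /g0.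
Qed.

Lemma cube_shift (R : realType) (N K : nat) (i : 'I_N) (x : 'rV[R]_N) (s : R) :
  `|s| <= 1 -> cube K (x + s *: basis_vec R i) -> cube K.+1 x.
Proof.
move=> s1 /forallP xK; apply/forallP => j; have := xK j.
rewrite !mxE eqxx /= -natr1; move: s1; rewrite ler_norml => /andP[s1 s2].
by case: (j == i); rewrite ?mulr1 ?mulr0 ?addr0 => /andP[a b]; apply/andP; split; lra.
Qed.

(** The Riemann sum of the difference quotient of g at step 1/t is zero by telescoping, and
    the quotient approximates the partial derivative uniformly, by the mean value theorem and
    the uniform continuity of that derivative on a cube. *)
Lemma grid_integral_partial (R : realType) (N K : nat) (i : 'I_N) (g : 'rV[R]_N -> R) :
  (forall x, derivable g x (basis_vec R i)) -> continuous (partial_deriv i g) ->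
  (forall x, ~~ cube K x -> g x = 0) ->
  grid_integral (partial_deriv i g) = 0.
Proof.
move=> dg cg g0; set d := partial_deriv i g; set v := basis_vec R i.
have d0 x : ~~ cube K.+1 x -> d x = 0 by exact: partial_deriv_out.
have sd : supported d by exact: (supported_continuous cg d0).
pose C : R := (2 * K.+2)%:R ^+ N.
have C0 : 0 <= C by exact: exprn_ge0.
apply/eqP; rewrite -normr_le0; apply/ler_addgt0Pr => e e0; rewrite add0r.
have eC0 : 0 < e / (C + 1) by rewrite divr_gt0//; lra.
have [M /= M0 HM] := unif_continuous_line K.+2 v cg eC0.
apply: (cvgr_to_le (cvg_norm (cvg_riemann_sum sd))).
have [n0 n0M] : exists n0 : nat, M^-1 < n0%:R.
  by exists (Num.truncn M^-1).+1; rewrite truncnS_gt.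
apply: (@near_grid _ (maxn n0 K.+3)) => t; rewrite geq_max => /andP[n0t Kt].
have t0 : 0 < t%:R :> R by rewrite ltr0n; lia.
have t1 : t%:R^-1 <= 1 :> R by rewrite invf_le1// ler1n; lia.
have tM : t%:R^-1 < M.
  rewrite invf_plt ?posrE//; apply: lt_le_trans n0M _.
  by rewrite ler_nat.
have quot x : `|t%:R * (g (x + t%:R^-1 *: v) - g x) - d x| <= e / (C + 1) * (cube K.+2 x)%:R.
  have [xK|xK] := boolP (cube K.+2 x); last first.
    have xK1 : ~~ cube K.+1 x by apply: contra xK; exact: cube_le.
    rewrite d0// (g0 x); last by apply: contra xK1; exact: cube_le.
    rewrite g0 ?subrr ?mulr0 ?subr0 ?normr0//; apply: contra xK1; apply: cube_shift.
    by rewrite ger0_norm// invr_ge0 ltW.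
  have h0 : 0 < t%:R^-1 :> R by rewrite invr_gt0.
  have dl (s : R) : is_derive s 1 (fun r : R => g (x + r *: v)) (d (x + s *: v)).
    by apply: is_derive_line; exact: dg.
  have [|c /[!in_itv]/= /andP[c0 c1]] := MVT h0 (fun s _ => dl s).
    by apply: derivable_within_continuous => s _; exact: (@ex_derive _ _ _ _ _ _ _ (dl s)).
  rewrite scale0r addr0 subr0 => ->.
  rewrite mulrCA mulfV ?gt_eqF// !mulr1; apply: HM => //=.
  by rewrite sub0r normrN gtr0_norm//; exact: lt_trans tM.
have -> : riemann_sum t d =
    - riemann_sum t (fun x => t%:R * (g (x + t%:R^-1 *: v) - g x) - d x).
  have -> : (fun x => t%:R * (g (x + t%:R^-1 *: v) - g x) - d x) =
    (fun x => t%:R * (-1 * g x + g (x + t%:R^-1 *: v)) + (-1 * d x + 0)).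
    by apply/funext => x; ring.
  rewrite !riemann_sum_linear (riemann_sum_shift (K := K))//; last by lia.
  have -> : riemann_sum t (fun _ : 'rV[R]_N => 0) = 0.
    by rewrite /riemann_sum big1 ?mulr0.
  by ring.
rewrite normrN; apply: (le_trans (normr_riemann_sum _ _ quot)); [lia|lia|].
rewrite -/C -mulrA ler_piMr ?(ltW e0)// mulrC ler_pdivrMr; lra.
Qed.

(** * Truncated powers of a quadratic polynomial *)

Lemma normr_grid_integral (R : realType) (N K : nat) (B : R) (f : 'rV[R]_N -> R) :
  (forall x, `|f x| <= B * (cube K x)%:R) ->
  `|grid_integral f| <= B * (2 * K)%:R ^+ N.
Proof.
move=> fB; have sf : supported f by exists K, B.
apply: (cvgr_to_le (cvg_norm (cvg_riemann_sum sf))).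
apply: (@near_grid _ (maxn 1 K)) => t; rewrite geq_max => /andP[t0 Kt].
exact: normr_riemann_sum.
Qed.

(** The truncated power s_+^p.  For p = 0 it is 1 also for negative s, hence the successors
    in the exponents below. *)
Definition pos_pow (R : realType) (p : nat) (s : R) : R := Num.max 0 s ^+ p.

Lemma pos_pow_ge0 (R : realType) (p : nat) (s : R) : 0 <= pos_pow p s.
Proof. by rewrite exprn_ge0// le_max lexx. Qed.

Lemma pos_powS (R : realType) (p : nat) (s : R) : pos_pow p.+2 s = s * pos_pow p.+1 s.
Proof.
by rewrite /pos_pow; case: (leP 0 s) => s0; rewrite ?exprS// !mul0r mulr0.
Qed.

Lemma pos_pow_le0 (R : realType) (p : nat) (s : R) : s <= 0 -> pos_pow p.+1 s = 0.
Proof. by move=> s0; rewrite /pos_pow max_l// expr0n. Qed.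

(** Exponent 2 is the least one for which a quadratic remainder is available.  Higher exponents
    follow from the recurrence s_+^(p+1) = s s_+^p.  The bound is uniform for bounded s, which is
    what differentiation under the integral requires. *)
Lemma pos_pow_taylor (R : realType) (p : nat) (B : R) : 0 <= B ->
  exists2 C : R, 0 <= C & forall s h, `|s| <= B -> `|s + h| <= B ->
  `|pos_pow p.+2 (s + h) - pos_pow p.+2 s - p.+2%:R * h * pos_pow p.+1 s| <= C * h ^+ 2.
Proof.
move=> B0; elim: p => [|p [C C0 IH]].
  exists 1 => // s h _ _; rewrite mul1r /pos_pow !expr1 ler_norml.
  by case: (leP 0 s) => s0; case: (leP 0 (s + h)) => sh0; apply/andP; split; nra.
exists (B * C + p.+2%:R * B ^+ p.+1) => [|s h sB shB].
  by rewrite addr_ge0 ?mulr_ge0 ?exprn_ge0.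
have -> : pos_pow p.+3 (s + h) - pos_pow p.+3 s - p.+3%:R * h * pos_pow p.+2 s =
  (s + h) * (pos_pow p.+2 (s + h) - pos_pow p.+2 s - p.+2%:R * h * pos_pow p.+1 s)
  + p.+2%:R * pos_pow p.+1 s * h ^+ 2.
  by rewrite 2!(pos_powS p.+1) (pos_powS p s) -[p.+3%:R]natr1; ring.
rewrite [leRHS]mulrDl; apply: (le_trans (ler_normD _ _)); apply: lerD.
  by rewrite normrM -[leRHS]mulrA ler_pM// IH.
have pB : pos_pow p.+1 s <= B ^+ p.+1.
  rewrite /pos_pow lerXn2r ?nnegrE ?le_max ?lexx ?ge_max ?B0//=.
  exact: le_trans (ler_norm _) sB.
have pp : 0 <= pos_pow p.+1 s by exact: pos_pow_ge0.
rewrite ger0_norm; last by apply: mulr_ge0; [exact: mulr_ge0|exact: sqr_ge0].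
by apply: ler_wpM2r; [exact: sqr_ge0|exact: ler_wpM2l].
Qed.

(** A quadratic remainder identifies a directional derivative.  It serves both for the bumps
    in x and for the moments in r. *)
Lemma is_derive_quadratic (R : realType) (V : normedModType R) (f : V -> R) (x v : V) (d C M : R) :
  0 < M -> (forall h : R, `|h| <= M -> `|f (x + h *: v) - f x - h * d| <= C * h ^+ 2) ->
  is_derive x v f d.
Proof.
move=> M0 H.
have C0 : 0 <= C.
  have := H M; rewrite gtr0_norm// lexx => /(_ isT) /(le_trans (normr_ge0 _)).
  by rewrite pmulr_lge0// exprn_gt0.
suff L : (fun h : R => h^-1 *: ((f \o shift x) (h *: v) - f x)) @ 0^' --> d.
  by split; [apply/cvg_ex; exists d|exact: cvg_lim L].
apply/cvgrPdist_le => e e0.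
have Me : 0 < Num.min M (e / (C + 1)) by rewrite lt_min M0 divr_gt0//; lra.
near=> h.
have h0 : h != 0 by near: h; exact: nbhs_dnbhs_neq.
have : `|h| <= Num.min M (e / (C + 1)).
  near: h; apply: dnbhs0_le; exact: Me.
rewrite le_min => /andP[hM he] /=.
have nh0 : 0 < `|h| by rewrite normr_gt0.
rewrite distrC -(ler_pM2l nh0) -normrM.
have -> : h * (h^-1 *: (f (h *: v + x) - f x) - d) = f (x + h *: v) - f x - h * d.
  by rewrite [h *: v + x]addrC /GRing.scale/= mulrBr mulrA divff// mul1r.
apply: (le_trans (H _ hM)); rewrite -real_normK ?num_real// expr2 mulrCA ler_pM2l//.
rewrite ler_pdivlMr in he; last by lra.
nra.
Unshelve. all: by end_near. Qed.

Definition sqdist (R : realType) (N : nat) (a x : 'rV[R]_N) : R :=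
  \sum_i (x 0 i - a 0 i) ^+ 2.

Definition bump (R : realType) (N : nat) (a : 'rV[R]_N) (p : nat) (r : R) (x : 'rV[R]_N) : R :=
  pos_pow p (r - sqdist a x).

Lemma sqdist_ge0 (R : realType) (N : nat) (a x : 'rV[R]_N) : 0 <= sqdist a x.
Proof. by apply: sumr_ge0 => i _; exact: sqr_ge0. Qed.

Lemma continuous_coordB (R : realType) (N : nat) (a : 'rV[R]_N) (i : 'I_N) :
  continuous (fun x : 'rV[R]_N => x 0 i - a 0 i).
Proof. move=> x; exact: (cvgB (@coord_continuous R 1 N 0 i x) (cvg_cst (a 0 i))). Qed.

Lemma continuous_sqdist (R : realType) (N : nat) (a : 'rV[R]_N) : continuous (sqdist a).
Proof.
move=> x.
have H (i : 'I_N) : {for x, continuous (fun x : 'rV[R]_N => (x 0 i - a 0 i) ^+ 2)}.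
  exact: (continuous_comp (@continuous_coordB R N a i x) (@exprn_continuous R 2 _)).
have E : sqdist a = \big[(fun f g : 'rV[R]_N -> R => (fun x => f x + g x))/cst 0]_i
    (fun x : 'rV[R]_N => (x 0 i - a 0 i) ^+ 2).
  by apply/funext => y; rewrite /sqdist; elim/big_rec2: _ => //= i s f _ ->.
rewrite E; elim/big_rec: _ => [|i f _ IH]; first exact: cst_continuous.
exact: (cvgD (H i) IH).
Qed.

Lemma continuous_pos_pow (R : realType) p : continuous (@pos_pow R p).
Proof.
move=> s; apply: (@continuous_comp _ _ _ (fun s : R => Num.max 0 s) (fun s => s ^+ p));
  last exact: exprn_continuous.
exact: (@continuous_max R R (cst 0) id s (@cvg_cst _ _ _ _ _) (@cvg_id _ _)).
Qed.

Lemma continuous_bump (R : realType) (N : nat) (a : 'rV[R]_N) p r : continuous (bump a p r).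
Proof.
move=> x.
have H : {for x, continuous (fun x => r - sqdist a x)}
   by exact: (cvgB (cvg_cst r) (@continuous_sqdist R N a x)).
exact: (continuous_comp H (@continuous_pos_pow R p _)).
Qed.

Lemma bump_out (R : realType) (N : nat) (a : 'rV[R]_N) (r0 : R) :
  exists K, forall p r x, r <= r0 -> ~~ cube K x -> bump a p.+1 r x = 0.
Proof.
pose M := \sum_i `|a 0 i| + `|r0| + 1.
have aM i : `|a 0 i| + `|r0| + 1 <= M.
  rewrite /M !lerD2r (bigD1 i)//= lerDl; exact: sumr_ge0.
(* A point outside this cube is at distance at least |r0| + 1 from a. *)
exists (Num.truncn M).+1 => p r x rr0; rewrite negb_forall => /existsP[i xi].
have MK : M < (Num.truncn M).+1%:R by rewrite truncnS_gt.
apply: pos_pow_le0; rewrite subr_le0; apply: (le_trans rr0).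
apply: (@le_trans _ _ ((x 0 i - a 0 i) ^+ 2)); last first.
  by rewrite /sqdist (bigD1 i)//= lerDl; apply: sumr_ge0 => j _; exact: sqr_ge0.
have : `|r0| + 1 <= `|x 0 i - a 0 i|.
  have := aM i; move: xi; rewrite negb_and -ltNge -leNgt => /orP[xi|xi].
  - have := ler_norm (- (x 0 i - a 0 i)); rewrite normrN.
    have := ler_norm (- a 0 i); rewrite normrN; lra.
  - have := ler_norm (x 0 i - a 0 i); have := ler_norm (a 0 i); lra.
rewrite -(real_normK (num_real (x 0 i - a 0 i))).
have := ler_norm r0; have := normr_ge0 r0; nra.
Qed.

Lemma sqdist_line (R : realType) (N : nat) (a x : 'rV[R]_N) (i : 'I_N) (h : R) :
  sqdist a (x + h *: basis_vec R i) = sqdist a x + h * (2 * (x 0 i - a 0 i)) + h ^+ 2.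
Proof.
rewrite /sqdist (bigD1 i)//= [in RHS](bigD1 i)//= !mxE !eqxx /=.
under eq_bigr => j ji do rewrite !mxE (negbTE ji) andbF mulr0 addr0.
by ring.
Qed.

(** Along a coordinate line the squared distance is a quadratic polynomial of the step h, so
    the Taylor estimate for truncated powers applies to the increment k = - 2 h y - h^2. *)
Lemma is_derive_bump (R : realType) (N : nat) (a : 'rV[R]_N) (p : nat) (r : R)
    (x : 'rV[R]_N) (i : 'I_N) :
  is_derive x (basis_vec R i) (bump a p.+2 r)
    (- 2 * p.+2%:R * ((x 0 i - a 0 i) * bump a p.+1 r x)).
Proof.
set y := x 0 i - a 0 i; set s := r - sqdist a x.
pose L := 2 * `|y| + 1; have L1 : 1 <= L by rewrite lerDr mulr_ge0.
have [|C C0 HC] := @pos_pow_taylor R p (`|s| + L); first by rewrite addr_ge0//; lra.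
apply: (@is_derive_quadratic _ _ _ _ _ _ (C * L ^+ 2 + p.+2%:R * pos_pow p.+1 s) 1) => // h h1.
pose k := - (h * (2 * y)) - h ^+ 2.
have hh : `|h| ^+ 2 <= `|h| by rewrite expr2 ler_piMr.
have kL : `|k| <= `|h| * L.
  rewrite /k /L -opprD normrN [leRHS]mulrDr mulr1; apply: (le_trans (ler_normD _ _)).
  by rewrite normrX !normrM normr_nat lerD.
have kL1 : `|k| <= L by apply: (le_trans kL); rewrite ler_piMl//; lra.
have := HC s k; rewrite lerDl; have -> : 0 <= L by lra.
move=> /(_ isT).
have -> : `|s + k| <= `|s| + L by apply: (le_trans (ler_normD _ _)); rewrite lerD2l.
move=> /(_ isT) T.
have -> : bump a p.+2 r (x + h *: basis_vec R i) - bump a p.+2 r x -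
  h * (- 2 * p.+2%:R * (y * bump a p.+1 r x)) =
  (pos_pow p.+2 (s + k) - pos_pow p.+2 s - p.+2%:R * k * pos_pow p.+1 s) -
   p.+2%:R * pos_pow p.+1 s * h ^+ 2.
  rewrite /bump sqdist_line -/y -/s.
  have -> : r - (sqdist a x + h * (2 * y) + h ^+ 2) = s + k by rewrite /s /k; ring.
  by rewrite /k; ring.
apply: (le_trans (ler_normB _ _)); rewrite [leRHS]mulrDl; apply: lerD.
  apply: (le_trans T); rewrite -mulrA ler_wpM2l//.
  rewrite -(real_normK (num_real k)) -(real_normK (num_real h)).
  by rewrite -exprMn mulrC lerXn2r ?nnegrE ?mulr_ge0//; lra.
rewrite ger0_norm//; apply: mulr_ge0; last exact: sqr_ge0.
by apply: mulr_ge0 => //; exact: pos_pow_ge0.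
Qed.

(** * Moments and their dependence on the radius *)

Lemma grid_integral_leZ (R : realType) (N : nat) (k : R) (f g : 'rV[R]_N -> R) :
  supported f -> supported g -> (forall x, k * f x <= g x) ->
  k * grid_integral f <= grid_integral g.
Proof.
move=> sf sg fg; rewrite -subr_ge0 addrC -mulNr -grid_integral_linear//.
apply: grid_integral_ge0; first exact: supported_linear.
by move=> x; rewrite mulNr addrC subr_ge0.
Qed.

(** The parameter r is the square of the radius of the ball that carries the weight. *)
Definition moment (R : realType) (N : nat) (a : 'rV[R]_N) (p : nat)
    (v : 'rV[R]_N -> R) (r : R) : R :=
  grid_integral (fun x => v x * bump a p r x).

Lemma continuousMbump (R : realType) (N : nat) (a : 'rV[R]_N) p r (v : 'rV[R]_N -> R) :
  continuous v -> continuous (fun x => v x * bump a p r x).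
Proof. by move=> cv x; exact: (cvgM (cv x) (@continuous_bump R N a p r x)). Qed.

Lemma supportedMbump (R : realType) (N : nat) (a : 'rV[R]_N) p r (v : 'rV[R]_N -> R) :
  continuous v -> supported (fun x => v x * bump a p.+1 r x).
Proof.
move=> cv; have [K HK] := bump_out a r.
apply: (@supported_continuous _ _ K); first exact: continuousMbump.
by move=> x xK; rewrite HK// mulr0.
Qed.

Lemma moment_linear (R : realType) (N : nat) (a : 'rV[R]_N) p r (k : R) (v w : 'rV[R]_N -> R) :
  continuous v -> continuous w ->
  moment a p.+1 (fun x => k * v x + w x) r = k * moment a p.+1 v r + moment a p.+1 w r.
Proof.
move=> cv cw; rewrite /moment -grid_integral_linear; [|exact: supportedMbump..].
by congr grid_integral; apply/funext => x; ring.
Qed.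

Lemma moment_ge0 (R : realType) (N : nat) (a : 'rV[R]_N) p r (v : 'rV[R]_N -> R) :
  continuous v -> (forall x, sqdist a x < r -> 0 <= v x) -> 0 <= moment a p.+1 v r.
Proof.
move=> cv v0; apply: grid_integral_ge0; first exact: supportedMbump.
move=> x; have [xr|xr] := ltP (sqdist a x) r.
  by rewrite mulr_ge0 ?v0// pos_pow_ge0.
by rewrite /bump pos_pow_le0 ?subr_le0// mulr0.
Qed.

(** Only the weight depends on r, so the Taylor estimate for truncated powers integrates
    directly; for steps of size at most 1 all supports lie in one cube. *)
Lemma is_derive_moment (R : realType) (N : nat) (a : 'rV[R]_N) p (r : R) (v : 'rV[R]_N -> R) :
  continuous v -> is_derive r 1 (moment a p.+2 v) (p.+2%:R * moment a p.+1 v r).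
Proof.
move=> cv; have [K HK] := bump_out a (r + 1).
have [V V0 HV] := bounded_on_cube K cv.
have [|C C0 HC] := @pos_pow_taylor R p (`|r| + 2); first by rewrite addr_ge0.
apply: (@is_derive_quadratic _ _ _ _ _ _ (V * C * (2 * K)%:R ^+ N) 1) => // h h1.
have [hl hu] : -1 <= h /\ h <= 1 by move: h1; rewrite ler_norml => /andP.
have -> : moment a p.+2 v (r + h *: 1) - moment a p.+2 v r -
    h * (p.+2%:R * moment a p.+1 v r) =
  grid_integral (fun x => v x * (bump a p.+2 (r + h) x - bump a p.+2 r x
    - p.+2%:R * h * bump a p.+1 r x)).
  have -> : (fun x => v x * (bump a p.+2 (r + h) x - bump a p.+2 r x
    - p.+2%:R * h * bump a p.+1 r x)) =
    (fun x => (- (p.+2%:R * h)) * (v x * bump a p.+1 r x) +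
      (-1 * (v x * bump a p.+2 r x) + v x * bump a p.+2 (r + h) x)).
    by apply/funext => x; ring.
  rewrite /GRing.scale/= mulr1 !grid_integral_linear; try exact: supportedMbump; last first.
    by apply: supported_linear; exact: supportedMbump.
  by rewrite /moment; ring.
rewrite mulrAC; apply: normr_grid_integral => x.
have [xK|xK] := boolP (cube K x); last first.
  by rewrite !HK// ?subrr ?mulr0 ?subr0 ?mulr0 ?normr0//; lra.
rewrite mulr1 normrM -!mulrA ler_pM// ?HV//.
have [xr|xr] := leP (sqdist a x) (r + 1); last first.
  rewrite /bump !pos_pow_le0; try lra.
  by rewrite !(mulr0, subr0) normr0; apply: mulr_ge0 => //; exact: sqr_ge0.
have q0 := sqdist_ge0 a x; have r1 := ler_norm r.
have r2 : - r <= `|r| by rewrite -normrN ler_norm.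
rewrite /bump [r + h - _]addrAC mulrA; apply: HC; rewrite ler_norml; apply/andP; split; lra.
Qed.

(** * Integration by parts against the bump weights *)

Lemma grid_integral_by_parts (R : realType) (N K : nat) (i : 'I_N) (f w dw : 'rV[R]_N -> R) :
  continuous f -> (forall x, derivable f x (basis_vec R i)) ->
  continuous (partial_deriv i f) ->
  continuous w -> (forall x, is_derive x (basis_vec R i) w (dw x)) -> continuous dw ->
  (forall x, ~~ cube K x -> w x = 0) ->
  grid_integral (fun x => partial_deriv i f x * w x) =
  - grid_integral (fun x => f x * dw x).
Proof.
move=> cf df cdf cw Dw cdw w0.
have dwE : dw = partial_deriv i w.
  by apply/funext => x; rewrite /partial_deriv (@derive_val _ _ _ _ _ _ _ (Dw x)).
have dw0 x : ~~ cube K.+1 x -> dw x = 0 by rewrite dwE; exact: partial_deriv_out.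
have s1 : supported (fun x => f x * dw x).
  apply: (@supported_continuous _ _ K.+1) => [x|x xK]; first exact: (cvgM (cf x) (cdw x)).
  by rewrite dw0// mulr0.
have s2 : supported (fun x => partial_deriv i f x * w x).
  apply: (@supported_continuous _ _ K) => [x|x xK]; first exact: (cvgM (cdf x) (cw x)).
  by rewrite w0// mulr0.
have E : partial_deriv i (fun x => f x * w x) =
    fun x => 1 * (f x * dw x) + partial_deriv i f x * w x.
  apply/funext => x; rewrite {1}/partial_deriv.
  have Dwx := Dw x; have Dfx := derivableP (df x).
  rewrite (@derive_val _ _ _ _ _ _ _ (is_deriveM Dfx Dwx)).
  by rewrite /GRing.scale/= mul1r [w x * _]mulrC.
apply/eqP; rewrite -addr_eq0 addrC -[grid_integral (fun x => f x * _)]mul1r.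
rewrite -grid_integral_linear// -E; apply/eqP; apply: (@grid_integral_partial _ _ K).
- by move=> x; apply: derivableM; [exact: df|exact: ex_derive].
- rewrite E; under eq_fun do rewrite mul1r.
  by move=> x; exact: (cvgD (cvgM (cf x) (cdw x)) (cvgM (cdf x) (cw x))).
- by move=> x xK; rewrite w0// mulr0.
Qed.

Lemma is_derive_coordB (R : realType) (N : nat) (a x : 'rV[R]_N) (i : 'I_N) :
  is_derive x (basis_vec R i) (fun x : 'rV[R]_N => x 0 i - a 0 i) 1.
Proof.
apply: (@is_derive_quadratic _ _ _ _ _ _ 0 1) => // h _.
by rewrite !mxE !eqxx /= !mulr1 mul0r normr_le0; apply/eqP; ring.
Qed.

Lemma grid_integral_sum (R : realType) (N n : nat) (F : 'I_n -> 'rV[R]_N -> R) :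
  (forall i, supported (F i)) ->
  grid_integral (fun x => \sum_i F i x) = \sum_i grid_integral (F i).
Proof.
move=> sF; suff [] : grid_integral (fun x => \sum_i F i x) = \sum_i grid_integral (F i) /\
  supported (fun x => \sum_i F i x) by [].
have E : (fun x => \sum_i F i x) = \big[(fun f g x => 1 * f x + g x)/(fun=> 0)]_i F i.
  by apply/funext => y; elim/big_rec2: _ => //= i s f _ ->; rewrite mul1r.
rewrite E; elim/big_rec2: _ => [|i f s _ [<- sf]].
  have H (x : 'rV[R]_N) : `|0 : R| <= 0 * (cube 0 x)%:R by rewrite normr0 mul0r.
  split; last by exists 0%N, 0.
  by apply/eqP; rewrite -normr_le0; have := normr_grid_integral H; rewrite mul0r.
split; last exact: supported_linear.
by rewrite grid_integral_linear// mul1r.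
Qed.

(** The first and second partial derivatives in direction i of the bump of exponent p + 3. *)
Definition bump_partial (R : realType) (N : nat) (a : 'rV[R]_N) p r (i : 'I_N)
    (x : 'rV[R]_N) : R :=
  - 2 * p.+3%:R * ((x 0 i - a 0 i) * bump a p.+2 r x).

Definition bump_partial2 (R : realType) (N : nat) (a : 'rV[R]_N) p r (i : 'I_N)
    (x : 'rV[R]_N) : R :=
  - 2 * p.+3%:R * (bump a p.+2 r x - 2 * p.+2%:R * ((x 0 i - a 0 i) ^+ 2 * bump a p.+1 r x)).

Lemma is_derive_bump_partial (R : realType) (N : nat) (a : 'rV[R]_N) p r (i : 'I_N) (x : 'rV[R]_N) :
  is_derive x (basis_vec R i) (bump_partial a p r i) (bump_partial2 a p r i x).
Proof.
have D1 := is_derive_coordB a x i; have D2 := is_derive_bump a p r x i.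
have := is_deriveZ (- 2 * p.+3%:R) (is_deriveM D1 D2).
rewrite /bump_partial2; move=> H; apply: is_derive_eq.
by rewrite /GRing.scale/=; ring.
Qed.

Lemma continuous_mulr (R : realType) (T : topologicalType) (f g : T -> R) :
  continuous f -> continuous g -> continuous (fun x => f x * g x).
Proof. by move=> cf cg x; exact: (cvgM (cf x) (cg x)). Qed.

Lemma continuous_bump_partial (R : realType) (N : nat) (a : 'rV[R]_N) p r (i : 'I_N) :
  continuous (bump_partial a p r i).
Proof.
apply: (@continuous_mulr _ _ (fun=> _)); first exact: cst_continuous.
by apply: continuous_mulr; [exact: continuous_coordB|exact: continuous_bump].
Qed.

Lemma continuous_bump_partial2 (R : realType) (N : nat) (a : 'rV[R]_N) p r (i : 'I_N) :
  continuous (bump_partial2 a p r i).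
Proof.
apply: (@continuous_mulr _ _ (fun=> _)); first exact: cst_continuous.
have cx : continuous (fun x : 'rV[R]_N => (x 0 i - a 0 i) ^+ 2).
  by move=> x; exact: (continuous_comp (@continuous_coordB R N a i x) (@exprn_continuous R 2 _)).
have cb q := @continuous_bump R N a q r.
have cc : continuous (fun x : 'rV[R]_N => 2 * p.+2%:R * ((x 0 i - a 0 i) ^+ 2 * bump a p.+1 r x)).
  by apply: (@continuous_mulr _ _ (fun=> _)); [exact: cst_continuous|exact: continuous_mulr].
by move=> x; exact: (cvgB (cb _ x) (cc x)).
Qed.

(** The Laplacian of a bump is again a combination of bumps, because |x - a|^2 is r minus the
    base of the truncated power. *)
Lemma sum_bump_partial2 (R : realType) (N : nat) (a : 'rV[R]_N) p r (x : 'rV[R]_N) :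
  \sum_i bump_partial2 a p r i x =
  p.+3%:R * (4 * p.+2%:R * r * bump a p.+1 r x - (4 * p.+2%:R + 2 * N%:R) * bump a p.+2 r x).
Proof.
have E : sqdist a x * bump a p.+1 r x = r * bump a p.+1 r x - bump a p.+2 r x.
  by rewrite /bump pos_powS; ring.
rewrite /bump_partial2 -mulr_sumr big_split/= sumr_const card_ord sumrN -mulr_sumr -mulr_suml E.
by rewrite -mulr_natr; ring.
Qed.

(** Two integrations by parts move the Laplacian to the weight. *)
Lemma moment_laplacian (R : realType) (N : nat) (a : 'rV[R]_N) p r (v : 'rV[R]_N -> R) :
  class_C 2 v ->
  moment a p.+3 (laplacian v) r =
  p.+3%:R * (4 * p.+2%:R * r * moment a p.+1 v r
             - (4 * p.+2%:R + 2 * N%:R) * moment a p.+2 v r).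
Proof.
move=> [cv Hv]; have [K HK] := bump_out a r.
have K1 x : ~~ cube K x -> bump a p.+3 r x = 0 by exact: HK.
have K2 i x : ~~ cube K x -> bump_partial a p r i x = 0.
  by move=> xK; rewrite /bump_partial HK// !mulr0.
have K3 i x : ~~ cube K x -> bump_partial2 a p r i x = 0.
  by move=> xK; rewrite /bump_partial2 !HK// !(mulr0, subrr).
have ibp i : grid_integral (fun x => partial_deriv i (partial_deriv i v) x * bump a p.+3 r x) =
    grid_integral (fun x => v x * bump_partial2 a p r i x).
  have [dv [cdv /(_ i) [ddv cddv]]] := Hv i.
  rewrite (grid_integral_by_parts cdv ddv cddv (@continuous_bump R N a p.+3 r)
    (fun x => is_derive_bump a p.+1 r x i) (@continuous_bump_partial R N a p r i) K1).
  rewrite (grid_integral_by_parts cv dv cdv (@continuous_bump_partial R N a p r i)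
    (is_derive_bump_partial a p r i) (@continuous_bump_partial2 R N a p r i) (K2 i)).
  by rewrite opprK.
have -> : moment a p.+3 (laplacian v) r = \sum_i
    grid_integral (fun x => v x * bump_partial2 a p r i x).
  rewrite /moment; under eq_bigr do rewrite -ibp.
  rewrite -grid_integral_sum; last first.
    by move=> i; apply: supportedMbump; have [_ [_ /(_ i) [_]]] := Hv i.
  by congr grid_integral; apply/funext => x; rewrite /laplacian mulr_suml.
rewrite -grid_integral_sum; last first.
  move=> i; apply: (@supported_continuous _ _ K) => [x|x xK]; last by rewrite K3// mulr0.
  exact: (cvgM (cv x) (@continuous_bump_partial2 R N a p r i x)).
transitivity (grid_integral (fun x => (p.+3%:R * (4 * p.+2%:R * r)) * (v x * bump a p.+1 r x) +
   ((- (p.+3%:R * (4 * p.+2%:R + 2 * N%:R))) * (v x * bump a p.+2 r x) + 0))).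
  by congr grid_integral; apply/funext => x; rewrite -mulr_sumr sum_bump_partial2; ring.
have s0 : supported (fun _ : 'rV[R]_N => 0 : R) by exists 0%N, 0 => x; rewrite normr0 mul0r.
rewrite !grid_integral_linear//; try exact: supportedMbump; last first.
  by apply: supported_linear => //; exact: supportedMbump.
have -> : grid_integral (fun _ : 'rV[R]_N => 0 : R) = 0.
  by have := @grid_integral_sum R N 0 (fun=> fun=> 0) (fun=> s0); rewrite !big_ord0.
by rewrite /moment; ring.
Qed.

(** * Means: differentiation, Jensen and comparison of radii *)

(** The normalising constant of the means; it equals a constant times r^(p + N/2), which is
    recovered from a differential equation instead of being computed. *)
Definition mass (R : realType) (N : nat) (a : 'rV[R]_N) (p : nat) (r : R) : R :=
  moment a p (fun=> 1) r.

Definition mean (R : realType) (N : nat) (a : 'rV[R]_N) (p : nat)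
    (v : 'rV[R]_N -> R) (r : R) : R :=
  moment a p v r / mass a p r.

Lemma class_C_cst (R : realType) (N k : nat) (b : R) : class_C k (fun _ : 'rV[R]_N => b).
Proof.
elim: k b => [|k IH] b; first exact: cst_continuous.
split; first exact: cst_continuous.
move=> i; split=> [x|]; first exact: derivable_cst.
have -> : partial_deriv i (fun _ : 'rV[R]_N => b) = fun=> 0; last exact: IH.
by apply/funext => x; rewrite /partial_deriv derive_cst.
Qed.

(** The case v = 1 of the formula for the moment of a Laplacian. *)
Lemma mass_recurrence (R : realType) (N : nat) (a : 'rV[R]_N) p (r : R) :
  4 * p.+2%:R * r * mass a p.+1 r = (4 * p.+2%:R + 2 * N%:R) * mass a p.+2 r.
Proof.
have := moment_laplacian a p r (@class_C_cst R N 2 1).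
have -> : laplacian (fun _ : 'rV[R]_N => 1 : R) = fun=> 0.
  apply/funext => x; rewrite /laplacian big1// => i _.
  have -> : partial_deriv i (fun _ : 'rV[R]_N => 1 : R) = fun=> 0.
    by apply/funext => y; rewrite /partial_deriv derive_cst.
  by rewrite /partial_deriv derive_cst.
have -> : moment a p.+3 (fun=> 0) r = 0.
  have := @moment_linear R N a p.+2 r (-1) (fun=> 0) (fun=> 0)
    (@cst_continuous _ _ _) (@cst_continuous _ _ _).
  have -> : (fun _ : 'rV[R]_N => -1 * 0 + 0 : R) = fun=> 0.
    by apply/funext => x; rewrite mulr0 addr0.
  by rewrite mulN1r addNr.
move=> /esym/eqP; rewrite mulf_eq0 pnatr_eq0/= subr_eq0 => /eqP H.
exact: H.
Qed.

Lemma is_derive_mass (R : realType) (N : nat) (a : 'rV[R]_N) p (r : R) :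
  is_derive r 1 (mass a p.+2) (p.+2%:R * mass a p.+1 r).
Proof. by apply: is_derive_moment; exact: cst_continuous. Qed.

Lemma is_derive_expV (R : realType) (k : nat) (r : R) : r != 0 ->
  is_derive r 1 (fun s : R => s ^- k) (- k%:R * r ^- k.+1).
Proof.
move=> r0; have := is_deriveX k (is_derive_id r 1); rewrite exprfctE => D.
have H : r ^+ k != 0 by rewrite expf_neq0.
have := @is_deriveV _ (fun s => s ^+ k) _ _ _ H D.
move=> D'; apply: is_derive_eq; rewrite /GRing.scale/=.
case: k {D D'} H => [|k] _ /=; first by rewrite !mul0r mulr0 oppr0 mul0r.
have : r ^+ k != 0 by rewrite expf_neq0.
by rewrite !exprS; move: (r ^+ k) => T T0; field; rewrite T0.
Qed.

(** The recurrence and the derivative of the mass combine into r c' = (p + 2 + N/2) c; squaring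
    avoids the half-integral exponent. *)
Lemma mass_power (R : realType) (N : nat) (a : 'rV[R]_N) p (r s : R) : 0 < r -> r < s ->
  mass a p.+2 s ^+ 2 * s ^- (2 * p.+2 + N) = mass a p.+2 r ^+ 2 * r ^- (2 * p.+2 + N).
Proof.
move=> r0 rs; set k := (2 * p.+2 + N)%N.
have D (t : R) : 0 < t -> is_derive t 1 (fun t => mass a p.+2 t ^+ 2 * t ^- k) 0.
  move=> t0; have tn : t != 0 by rewrite gt_eqF.
  have := is_deriveX 2 (is_derive_mass a p t); rewrite exprfctE => Dm.
  have DV := is_derive_expV k tn.
  have := is_deriveM Dm DV => D'; apply: is_derive_eq.
  rewrite /GRing.scale/= expr1.
  have E : p.+2%:R * mass a p.+1 t = (4 * p.+2%:R + 2 * N%:R) * mass a p.+2 t / (4 * t).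
    by rewrite -mass_recurrence; field.
  have Ek : k%:R = 2 * p.+2%:R + N%:R :> R by rewrite natrD natrM.
  have -> : t ^- k.+1 = t ^- k / t by rewrite exprSr invfM.
  by rewrite E Ek; field; rewrite ?expf_neq0 ?tn.
have [||c] := @MVT_segment R (fun t => mass a p.+2 t ^+ 2 * t ^- k) (fun=> 0) r s (ltW rs).
- by move=> t; rewrite in_itv/= => /andP[rt _]; apply: D; exact: lt_trans rt.
- apply: derivable_within_continuous => t; rewrite in_itv/= => /andP[rt _].
  by apply: (@ex_derive _ _ _ _ _ _ _ (D t _)); exact: lt_le_trans rt.
- by move=> _; rewrite mul0r => /eqP; rewrite subr_eq0 => /eqP.
Qed.

Lemma mass_ge0 (R : realType) (N : nat) (a : 'rV[R]_N) p (r : R) : 0 <= mass a p.+1 r.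
Proof. by apply: moment_ge0 => //; exact: cst_continuous. Qed.

Lemma mass_gt0_large (R : realType) (N : nat) (a : 'rV[R]_N) p :
  exists r0 : R, forall r, r0 <= r -> 0 < mass a p.+1 r.
Proof.
have [D D0 HD] := bounded_on_cube 1 (@continuous_sqdist R N a).
exists (D + 1) => r Dr.
have cb := supportedMbump a p r (@cst_continuous _ _ (1 : R)).
apply: (@lt_le_trans _ _ (grid_integral (fun x : 'rV[R]_N => (cube 1 x)%:R))).
  by rewrite grid_integral_cube exprn_gt0.
have : 0 <= grid_integral (fun x => -1 * (cube 1 x)%:R + 1 * bump a p.+1 r x).
  apply: grid_integral_ge0; first exact: supported_linear (@supported_cube _ _ _) cb.
  move=> x; have [x1|x1] := boolP (cube 1 x); last by rewrite mulr0 add0r mul1r pos_pow_ge0.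
  rewrite mulr1 mul1r addrC subr_ge0 exprn_ege1// le_max; apply/orP; right.
  have := HD x x1; rewrite ger0_norm ?sqdist_ge0//; lra.
by rewrite grid_integral_linear//; [rewrite mulN1r addrC subr_ge0|exact: supported_cube].
Qed.

(** For large r the weight dominates the indicator of the unit cube, and the power law carries
    positivity down to all radii. *)
Lemma mass_gt0 (R : realType) (N : nat) (a : 'rV[R]_N) p (r : R) : 0 < r -> 0 < mass a p.+2 r.
Proof.
move=> r0; rewrite lt_neqAle mass_ge0 andbT eq_sym; apply/eqP => m0.
have [r1 Hr1] := @mass_gt0_large R N a p.+1.
have rs : r < Num.max r1 (r + 1) by rewrite lt_max ltrDl ltr01 orbT.
have := mass_power a p r0 rs; rewrite m0 expr0n mul0r => /eqP.
rewrite mulf_eq0 invr_eq0 !expf_eq0/= !gt_eqF ?andbF//.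
  by rewrite (lt_trans r0).
by rewrite Hr1// le_max lexx.
Qed.

Lemma mass_doubling (R : realType) (N : nat) (a : 'rV[R]_N) p (r s : R) :
  0 < r -> r <= s -> s <= 2 * r -> mass a p.+2 s <= 2 ^+ (2 * p.+2 + N) * mass a p.+2 r.
Proof.
move=> r0 rs s2r; set k := (2 * p.+2 + N)%N.
have k1 : 1 <= 2 ^+ k :> R by rewrite exprn_ege1// ler1n.
have [->|rs'] := eqVneq s r; first by rewrite ler_peMl// ltW// mass_gt0.
have {}rs : r < s by rewrite lt_neqAle eq_sym rs'.
have s0 : 0 < s by exact: lt_trans rs.
have := mass_power a p r0 rs; rewrite -/k => E.
have {}E : mass a p.+2 s ^+ 2 = mass a p.+2 r ^+ 2 * (s / r) ^+ k.
  by rewrite expr_div_n mulrCA -E mulrCA divff ?mulr1// gt_eqF// exprn_gt0.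
have mr := mass_gt0 a p r0; have ms := mass_gt0 a p s0.
have m2 : 0 <= 2 ^+ k * mass a p.+2 r by rewrite mulr_ge0 ?exprn_ge0// ltW.
rewrite -(@ler_pXn2r _ 2) ?nnegrE ?(ltW ms)// E [leRHS]exprMn [leLHS]mulrC.
apply: ler_wpM2r; first exact: sqr_ge0.
apply: (@le_trans _ _ (2 ^+ k)).
  by rewrite lerXn2r ?nnegrE ?divr_ge0 ?(ltW s0) ?(ltW r0)// ler_pdivrMr.
by rewrite [leRHS]expr2 ler_peMl//; lra.
Qed.

(** The quotient rule produces exactly the combination of moments that appears in the moment
    of a Laplacian with the next exponent; the recurrence for the masses absorbs the rest.
    Hence repeated differentiation in r produces means of iterated Laplacians. *)
Lemma is_derive_mean (R : realType) (N : nat) (a : 'rV[R]_N) p (v : 'rV[R]_N -> R) (r : R) :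
  class_C 2 v -> 0 < r ->
  is_derive r 1 (mean a p.+2 v)
    ((4 * p.+3%:R + 2 * N%:R)^-1 * mean a p.+3 (laplacian v) r).
Proof.
move=> cv r0; have m0 := mass_gt0 a p r0.
have mn0 : mass a p.+2 r != 0 by rewrite gt_eqF.
have Dm := is_derive_mass a p r; have DJ := is_derive_moment a p r cv.1.
have := is_deriveM DJ (is_deriveV mn0 Dm) => D; apply: is_derive_eq.
rewrite /GRing.scale/= /mean moment_laplacian//.
have K0 : 0 < 4 * p.+3%:R + 2 * N%:R :> R by rewrite ltr_wpDr ?mulr_ge0 ?mulr_gt0.
have E1 : p.+2%:R * mass a p.+1 r = (4 * p.+2%:R + 2 * N%:R) * mass a p.+2 r / (4 * r).
  by rewrite -mass_recurrence; field; rewrite gt_eqF.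
have E2 : mass a p.+3 r = 4 * p.+3%:R * r * mass a p.+2 r / (4 * p.+3%:R + 2 * N%:R).
  by rewrite (mass_recurrence a p.+1 r); field; rewrite gt_eqF.
have p0 : p.+3%:R != 0 :> R by rewrite pnatr_eq0.
rewrite E1 E2; field.
by rewrite mn0 !gt_eqF.
Qed.

Lemma mean_ge (R : realType) (N : nat) (a : 'rV[R]_N) p (v : 'rV[R]_N -> R) (b r : R) :
  continuous v -> 0 < r -> (forall x, sqdist a x < r -> b <= v x) -> b <= mean a p.+2 v r.
Proof.
move=> cv r0 bv; rewrite ler_pdivlMr ?mass_gt0// -subr_ge0.
have cc c : continuous (fun _ : 'rV[R]_N => c : R) by exact: cst_continuous.
have -> : moment a p.+2 v r - b * mass a p.+2 r = moment a p.+2 (fun x => (- b) * 1 + v x) r.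
  by rewrite moment_linear// /mass; ring.
apply: moment_ge0 => [x|x /bv]; last by rewrite mulr1 addrC subr_ge0.
exact: (cvgD (cc (- b * 1) x) (cv x)).
Qed.

(** Integrate the tangent inequality exp t >= exp m (1 + t - m) at m = mean of v. *)
Lemma mean_jensen (R : realType) (N : nat) (a : 'rV[R]_N) p (v : 'rV[R]_N -> R) (r : R) :
  continuous v -> 0 < r ->
  expR (mean a p.+2 v r) <= mean a p.+2 (fun x => expR (v x)) r.
Proof.
move=> cv r0; set m := mean a p.+2 v r.
have cc c : continuous (fun _ : 'rV[R]_N => c : R) by exact: cst_continuous.
have ce : continuous (fun x => expR (v x)).
  by move=> x; exact: (continuous_comp (cv x) (@continuous_expR R _)).
have m0 := mass_gt0 a p r0.
have mE : moment a p.+2 v r = m * mass a p.+2 r by rewrite /m /mean divfK// gt_eqF.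
rewrite ler_pdivlMr// -subr_ge0.
have -> : moment a p.+2 (fun x => expR (v x)) r - expR m * mass a p.+2 r =
   moment a p.+2 (fun x => (- expR m) * v x + ((- expR m * (1 - m)) * 1 + expR (v x))) r.
  rewrite moment_linear//; last first.
    by move=> x; exact: (cvgD (cc (- expR m * (1 - m) * 1) x) (ce x)).
  by rewrite moment_linear// mE /mass; ring.
apply: moment_ge0 => [x|x _].
  apply: (cvgD (cvgM (cc (- expR m) x) (cv x)) (cvgD (cc (- expR m * (1 - m) * 1) x) (ce x))).
have := expR_ge1Dx (v x - m); rewrite -(ler_pM2l (expR_gt0 m)) -expRD.
have -> : m + (v x - m) = v x by ring.
by lra.
Qed.

(** Lowering the exponent from L + p + 2 to p + 2 costs a smaller radius s: on the support of
    the weight of s one has r - q >= s - q and r - q >= r - s, with q the squared distance.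
    The masses for s and r are comparable by doubling. *)
Lemma mean_delay (R : realType) (N : nat) (a : 'rV[R]_N) p L (v : 'rV[R]_N -> R) (r s : R) :
  continuous v -> (forall x, 0 <= v x) -> 0 < s -> s <= r -> r <= 2 * s ->
  2 ^- (2 * p.+2 + N) * ((r - s) / r) ^+ L * mean a p.+2 v s <= mean a (L + p).+2 v r.
Proof.
move=> cv v0 s0 sr r2s; have r0 : 0 < r by exact: lt_le_trans sr.
have bL x : (r - s) ^+ L * bump a p.+2 s x <= bump a (L + p).+2 r x.
  have [sx|sx] := ltP s (sqdist a x).
    by rewrite /bump pos_pow_le0 ?mulr0 ?pos_pow_ge0// subr_le0 ltW.
  rewrite /bump -!addnS /pos_pow exprD !max_r ?subr_ge0 ?(le_trans sx)//.
  by apply: ler_pM; rewrite ?exprn_ge0 ?subr_ge0// lerXn2r ?nnegrE ?subr_ge0 ?(le_trans sx)// lerB.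
have bR x : bump a (L + p).+2 r x <= r ^+ L * bump a p.+2 r x.
  have [rx|rx] := ltP r (sqdist a x).
    by rewrite /bump !pos_pow_le0 ?mulr0// subr_le0 ltW.
  have q0 := sqdist_ge0 a x.
  rewrite /bump -!addnS /pos_pow exprD !max_r ?subr_ge0//.
  by apply: ler_wpM2r; rewrite ?exprn_ge0 ?lerXn2r ?nnegrE ?subr_ge0// ?(ltW r0)//; lra.
have HL : (r - s) ^+ L * moment a p.+2 v s <= moment a (L + p).+2 v r.
  apply: grid_integral_leZ => [||x]; [exact: supportedMbump..|].
  by rewrite mulrCA ler_wpM2l.
have HR : mass a (L + p).+2 r <= r ^+ L * mass a p.+2 r.
  rewrite mulrC -ler_pdivrMr ?exprn_gt0// mulrC.
  apply: grid_integral_leZ => [||x]; [exact: supportedMbump (@cst_continuous _ _ _)..|].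
  by rewrite !mul1r mulrC ler_pdivrMr ?exprn_gt0// mulrC.
have mr := mass_gt0 a p r0; have ms := mass_gt0 a p s0.
have mL := mass_gt0 a (L + p) r0.
have D := mass_doubling a p s0 sr r2s.
set k := (2 * p.+2 + N)%N in D *.
have M0 : 0 <= moment a p.+2 v s by apply: moment_ge0.
rewrite [leRHS]/mean ler_pdivlMr//; apply: le_trans HL.
apply: (@le_trans _ _ (2 ^- k * ((r - s) / r) ^+ L * mean a p.+2 v s *
    (r ^+ L * (2 ^+ k * mass a p.+2 s)))).
  apply: ler_wpM2l.
    by rewrite !mulr_ge0 ?invr_ge0 ?exprn_ge0 ?(ltW ms)// divr_ge0 ?subr_ge0// ltW.
  by apply: (le_trans HR); rewrite ler_wpM2l// exprn_ge0// ltW.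
rewrite /mean expr_div_n le_eqVlt; apply/orP; left; apply/eqP; field.
by rewrite !gt_eqF// exprn_gt0.
Qed.

(** * Blow-up of a delayed exponential inequality *)

Lemma increment_ge (R : realType) (f df : R -> R) (K a b : R) :
  a <= b -> (forall t, a <= t -> t <= b -> is_derive t 1 f (df t)) ->
  (forall t, a <= t -> t <= b -> K <= df t) -> K * (b - a) <= f b - f a.
Proof.
move=> ab D H; have [||c] := @MVT_segment R f df a b ab.
- by move=> t; rewrite in_itv/= => /andP[/ltW at_ /ltW tb]; exact: D.
- apply: derivable_within_continuous => t; rewrite in_itv/= => /andP[at_ tb].
  exact: (@ex_derive _ _ _ _ _ _ _ (D t at_ tb)).
- rewrite in_itv/= => /andP[ac cb] ->.
  by rewrite ler_wpM2r ?subr_ge0// H.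
Qed.

Lemma unbounded_of_derive_ge (R : realType) (f df : R -> R) (d r0 : R) :
  0 < d -> (forall t, r0 <= t -> is_derive t 1 f (df t)) ->
  (forall t, r0 <= t -> d <= df t) ->
  forall Y, exists2 r1, r0 <= r1 & forall t, r1 <= t -> Y <= f t.
Proof.
move=> d0 D H Y; exists (r0 + `|Y - f r0| / d).
  by rewrite lerDl divr_ge0// ltW.
move=> t rt; have r0t : r0 <= t.
  by apply: le_trans rt; rewrite lerDl divr_ge0// ltW.
have := @increment_ge R f df d r0 t r0t (fun u ru _ => D u ru) (fun u ru _ => H u ru).
have : `|Y - f r0| <= d * (t - r0) by rewrite mulrC -ler_pdivrMr// lerBrDl.
have := ler_norm (Y - f r0); lra.
Qed.

Section Blowup.
Context (R : realType) (L : nat) (A : nat -> R -> R) (C : R) (L2 : (2 <= L)%N).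
Context (dA : forall (j : nat) (r : R), (j < L)%N -> 0 < r -> is_derive r 1 (A j) (A j.+1 r)).
Context (A_gt0 : forall r : R, 0 < r -> 0 < A L.-1 r) (C0 : 0 < C).
Context (delay : forall s r : R, 0 < s -> s <= r -> r <= 2 * s ->
  C * ((r - s) / r) ^+ L * expR (A 0 s) <= A L r).

Lemma AL_gt0 r : 0 < r -> 0 < A L r.
Proof.
move=> r0; have h : 0 < r / 2 by rewrite divr_gt0.
apply: lt_le_trans (delay h _ _); [|lra|lra].
apply: mulr_gt0 (expR_gt0 _); apply: mulr_gt0 => //; apply: exprn_gt0.
by apply: divr_gt0 => //; lra.
Qed.

(** Downward induction on the order of the derivative: a positive lower bound for one derivative
    makes the preceding one tend to infinity. *)
Lemma eventually_ge k : (k <= L.-1)%N ->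
  exists2 d, 0 < d & exists2 r0, 1 <= r0 & forall r, r0 <= r -> d <= A (L.-1 - k) r.
Proof.
have LE : L = L.-1.+1 by lia.
elim: k => [_|k IH kl].
  exists (A L.-1 1); first exact: A_gt0.
  exists 1 => // r r1; rewrite subn0 -subr_ge0.
  have := @increment_ge R (A L.-1) (A L) 0 1 r r1; rewrite mul0r; apply.
  - by move=> t t1 _; rewrite {2}LE; apply: dA; [lia|exact: lt_le_trans t1].
  - by move=> t t1 _; apply/ltW/AL_gt0; exact: lt_le_trans t1.
have [d d0 [r0 r01 H]] := IH (ltnW kl).
have E : (L.-1 - k = (L.-1 - k.+1).+1)%N by lia.
rewrite E in H; exists 1 => //.
have [|r1 r01' H'] :=
    @unbounded_of_derive_ge R (A (L.-1 - k.+1)) (A (L.-1 - k.+1).+1) d r0 d0 _ H 1.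
  by move=> t rt; apply: dA; [lia|apply: lt_le_trans rt; exact: lt_le_trans r01].
by exists r1 => //; exact: le_trans r01'.
Qed.

Lemma eventually_ge0 k : (k <= L)%N ->
  exists2 r0, 1 <= r0 & forall j r, (j < k)%N -> r0 <= r -> 0 <= A j r.
Proof.
elim: k => [_|k IH kL]; first by exists 1.
have [r0 r01 H0] := IH (ltnW kL).
have [|d d0 [r1 r11 H1]] := @eventually_ge (L.-1 - k); first by lia.
exists (Num.max r0 r1) => [|j r]; first by rewrite le_max r01.
rewrite ltnS leq_eqVlt ge_max => /orP[/eqP->|jk] /andP[r0r r1r]; last exact: H0.
have := H1 _ r1r; have -> : (L.-1 - (L.-1 - k) = k)%N by lia.
by apply: le_trans; exact: ltW.
Qed.

Lemma A0_unbounded Y : exists2 r0, 1 <= r0 & forall r, r0 <= r -> Y <= A 0 r.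
Proof.
have [|d d0 [r0 r01 H]] := @eventually_ge L.-2; first by lia.
have E : (L.-1 - L.-2 = 1)%N by lia.
rewrite E in H.
have [|r1 r01' H'] := @unbounded_of_derive_ge R (A 0) (A 1) d r0 d0 _ H Y.
  by move=> t rt; apply: dA; [lia|]; apply: lt_le_trans rt; exact: lt_le_trans r01.
by exists r1 => //; exact: le_trans r01'.
Qed.

(** A crude form of Taylor's inequality: each of the L steps of length d gains one factor d,
    which avoids integrating powers. *)
Lemma taylor_ge (r d K : R) : 0 < r -> 0 <= d -> 0 <= K ->
  (forall j t, (j < L)%N -> r <= t -> 0 <= A j t) ->
  (forall t, r <= t -> t <= r + L%:R * d -> K <= A L t) ->
  K * d ^+ L <= A 0 (r + L%:R * d).
Proof.
move=> r0 d0 K0 A0 AK.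
suff H k : (k <= L)%N -> forall t, r + k%:R * d <= t -> t <= r + L%:R * d ->
    K * d ^+ k <= A (L - k) t.
  by have := H L (leqnn _) _ (lexx _) (lexx _); rewrite subnn.
elim: k => [_ t|k IH kL t].
  by rewrite mul0r addr0 expr0 mulr1 subn0; exact: AK.
have E : (L - k = (L - k.+1).+1)%N by lia.
have kj : (L - k.+1 < L)%N by lia.
rewrite -natr1 mulrDl mul1r addrA => kt tL.
set s := r + k%:R * d in IH kt *.
have rs : r <= s by rewrite lerDl mulr_ge0.
have st : s <= t by apply: le_trans kt; rewrite lerDl.
have As : 0 <= A (L - k.+1) s by exact: A0.
have Du u : s <= u -> u <= t -> is_derive u 1 (A (L - k.+1)) (A (L - k) u).
  move=> su ut; rewrite E; apply: dA => //.
  by apply: lt_le_trans su; exact: lt_le_trans rs.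
have Ku u : s <= u -> u <= t -> K * d ^+ k <= A (L - k) u.
  by move=> su ut; apply: IH => //; [exact: ltnW|exact: le_trans tL].
have := increment_ge st Du Ku.
have : K * d ^+ k.+1 <= K * d ^+ k * (t - s).
  by rewrite exprSr mulrA ler_wpM2l ?mulr_ge0 ?exprn_ge0//; lra.
lra.
Qed.

(** With r_n = r0 (2 - 2^-n), one step of the delayed inequality followed by the Taylor bound
    gives A_0(r_(n+1)) >= G B^-n A_0(r_n)^2 with B = 4^L and G depending only on
    C and L, using exp y >= y^2 / 4.  If A_0(r_0) >= Z = B / G, then A_0(r_n) >= Z B^n for
    all n, although A_0 is bounded by A_0(2 r0). *)
Lemma ode_blowup : False.
Proof.
(* A step has length d >= q h n with h n = 2^-n, and d / (2 r0) >= q h n as well. *)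
pose q : R := (4 * L.+1%:R)^-1; have q0 : 0 < q by rewrite invr_gt0 mulr_gt0.
pose G := C * q ^+ (2 * L) / 4; have G0 : 0 < G by rewrite divr_gt0// mulr_gt0// exprn_gt0.
pose B : R := 2 ^+ (2 * L); have B0 : 0 < B by rewrite exprn_gt0.
pose Z := B / G; have Z0 : 0 < Z by rewrite divr_gt0.
have [r1 r11 H1] := eventually_ge0 (leqnn L).
have [r2 r21 H2] := A0_unbounded Z.
pose r0 := Num.max r1 r2; have r01 : 1 <= r0 by rewrite le_max r11.
have r00 : 0 < r0 by exact: lt_le_trans r01.
have A0 j t : (j < L)%N -> r0 <= t -> 0 <= A j t.
  by move=> jL; rewrite ge_max => /andP[? _]; exact: H1.
pose h n : R := 2 ^- n; have h0 n : 0 < h n by rewrite invr_gt0 exprn_gt0.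
have h1 n : h n <= 1 by rewrite invf_le1 ?exprn_gt0// exprn_ege1// ler1n.
have hS n : h n.+1 = h n / 2 by rewrite /h exprSr invfM.
pose r n := r0 * (2 - h n).
have rr0 n : r0 <= r n by rewrite ler_peMr ?(ltW r00)//; have := h1 n; lra.
have r2r0 n : r n <= 2 * r0 by rewrite /r [leRHS]mulrC ler_wpM2l ?(ltW r00)//; have := h0 n; lra.
have key n : Z * B ^+ n <= A 0 (r n).
  elim: n => [|n IH].
    by rewrite expr0 mulr1; apply: H2; apply: le_trans (rr0 0); rewrite le_max lexx orbT.
  (* L + 1 equal steps from r n to r n.+1: the first one is spent on the delay, the
     other L on the Taylor bound. *)
  pose d := r0 * h n.+1 / L.+1%:R.
  have d0 : 0 < d by rewrite divr_gt0// mulr_gt0.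
  have rS : r n.+1 = (r n + d) + L%:R * d.
    have -> : (r n + d) + L%:R * d = r n + L.+1%:R * d by rewrite -natr1; ring.
    by rewrite /d mulrCA divff ?pnatr_eq0// mulr1 /r hS; field.
  have rn0 : 0 < r n by exact: lt_le_trans (rr0 n).
  have dq : q * h n <= d / (2 * r0).
    rewrite /d hS /q le_eqVlt; apply/orP; left; apply/eqP; field.
    by rewrite gt_eqF//= addrC natr1 pnatr_eq0.
  have dq' : q * h n <= d.
    apply: (le_trans dq); rewrite ler_pdivrMr ?mulr_gt0// ler_peMr ?ltW//; lra.
  have qh0 : 0 <= q * h n by rewrite mulr_ge0// ltW.
  pose K := C * (q * h n) ^+ L * expR (A 0 (r n)).
  have K0 : 0 <= K by rewrite !mulr_ge0 ?exprn_ge0 ?expR_ge0 ?(ltW C0).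
  have := @taylor_ge (r n + d) d K _ (ltW d0) K0; rewrite -rS => T.
  have {}T : K * d ^+ L <= A 0 (r n.+1).
    apply: T; first exact: addr_gt0.
    - move=> j t jL rt; apply: A0 => //; apply: le_trans rt.
      by apply: le_trans (rr0 n) _; rewrite lerDl ltW.
    - move=> t rt tr; have rnt : r n <= t by apply: le_trans rt; rewrite lerDl ltW.
      have t2 : t <= 2 * r0 by apply: le_trans (r2r0 n.+1).
      have t0 : 0 < t by exact: lt_le_trans rnt.
      apply: le_trans (delay rn0 rnt _); last by apply: (le_trans t2); rewrite ler_pM2l.
      have qt : q * h n <= (t - r n) / t.
        apply: (le_trans dq); apply: ler_pM.
        - exact: ltW.
        - by rewrite invr_ge0 ltW// mulr_gt0.
        - by rewrite lerBrDl.
        - by rewrite lef_pV2 ?posrE ?mulr_gt0.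
      apply: ler_wpM2r; first exact: expR_ge0.
      apply: ler_wpM2l; first exact: ltW.
      by rewrite lerXn2r ?nnegrE// (le_trans qh0).
  apply: le_trans T.
  have yy : (A 0 (r n)) ^+ 2 / 4 <= expR (A 0 (r n)).
    have Ar : 0 <= A 0 (r n) by apply: A0 => //; exact: ltnW.
    have -> : A 0 (r n) = A 0 (r n) / 2 + A 0 (r n) / 2 by lra.
    have := expR_ge1Dx (A 0 (r n) / 2); rewrite expRD; nra.
  have ZBn : 0 <= Z * B ^+ n by rewrite mulr_ge0 ?exprn_ge0 ?ltW.
  apply: (@le_trans _ _ (C * (q * h n) ^+ L * ((Z * B ^+ n) ^+ 2 / 4) * (q * h n) ^+ L)).
    rewrite le_eqVlt; apply/orP; left; apply/eqP.
    have -> : C * (q * h n) ^+ L * ((Z * B ^+ n) ^+ 2 / 4) * (q * h n) ^+ L =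
       G * Z ^+ 2 * (B ^+ n) ^+ 2 * (h n) ^+ (2 * L).
      by rewrite /G mul2n -addnn !exprD !exprMn; ring.
    have -> : (h n) ^+ (2 * L) = (B ^+ n)^-1 by rewrite /h /B exprVn -!exprM mulnC.
    have : B ^+ n != 0 by rewrite gt_eqF// exprn_gt0.
    rewrite exprSr /Z; move: (B ^+ n) => b b0; field.
    by rewrite b0 gt_eqF.
  have P0 : 0 <= C * (q * h n) ^+ L by apply: mulr_ge0; [exact: ltW|exact: exprn_ge0].
  apply: ler_pM.
  - by apply: mulr_ge0 => //; apply: divr_ge0 => //; exact: sqr_ge0.
  - exact: exprn_ge0.
  - apply: ler_wpM2l => //; apply: le_trans yy; rewrite ler_wpM2r//.
    by rewrite lerXn2r ?nnegrE// (le_trans ZBn).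
  - by rewrite lerXn2r ?nnegrE// ltW.
have mono n : A 0 (r n) <= A 0 (2 * r0).
  have := @increment_ge R (A 0) (A 1) 0 (r n) (2 * r0) (r2r0 n).
  rewrite mul0r subr_ge0; apply => t rt _.
  - by apply: dA; [lia|]; apply: lt_le_trans rt; exact: lt_le_trans (rr0 n).
  - by apply: A0 => //; exact: le_trans rt.
pose n := (Num.truncn (A 0 (2 * r0) / Z)).+1.
have : A 0 (2 * r0) / Z < n%:R by rewrite truncnS_gt.
rewrite ltr_pdivrMr// => /(le_lt_trans (mono n))/(le_lt_trans (key n)).
rewrite mulrC ltr_pM2r// ltNge => /negP; apply.
rewrite /B -exprM -natrX ler_nat; apply: ltnW; apply: (leq_trans (ltn_expl n (isT : 1 < 2)%N)).
by rewrite leq_exp2l//; apply: leq_pmull; rewrite muln_gt0/=; exact: ltnW.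
Qed.
End Blowup.

(** * Smoothness of iterated Laplacians and the sign at the centre *)

Lemma class_C_continuous (R : realType) (N k : nat) (u : 'rV[R]_N -> R) :
  class_C k u -> continuous u.
Proof. by case: k => [|k] // []. Qed.

Lemma class_C_pred (R : realType) (N k : nat) (u : 'rV[R]_N -> R) :
  class_C k.+1 u -> class_C k u.
Proof.
elim: k u => [|k IH] u [cu Hu] //; split=> // i; have [du cdu] := Hu i.
by split=> //; exact: IH.
Qed.

Lemma class_C_le (R : realType) (N j k : nat) (u : 'rV[R]_N -> R) :
  (j <= k)%N -> class_C k u -> class_C j u.
Proof.
move=> jk; rewrite -(subnKC jk); elim: (k - j)%N => [|n IH]; first by rewrite addn0.
by rewrite addnS => /class_C_pred.
Qed.

Lemma class_C_add (R : realType) (N k : nat) (u v : 'rV[R]_N -> R) :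
  class_C k u -> class_C k v -> class_C k (fun x => u x + v x).
Proof.
have cD (f g : 'rV[R]_N -> R) : continuous f -> continuous g -> continuous (fun x => f x + g x).
  by move=> cf cg x; exact: (cvgD (cf x) (cg x)).
elim: k u v => [|k IH] u v; first exact: cD.
move=> [cu Hu] [cv Hv]; split; first exact: cD.
move=> i; have [du cdu] := Hu i; have [dv cdv] := Hv i; split.
  by move=> x; exact: derivableD.
have -> : partial_deriv i (fun x => u x + v x) =
    fun x => partial_deriv i u x + partial_deriv i v x.
  by apply/funext => x; exact: deriveD.
exact: IH.
Qed.

Lemma class_C_laplacian (R : realType) (N k : nat) (u : 'rV[R]_N -> R) :
  class_C k.+2 u -> class_C k (laplacian u).
Proof.
move=> [_ Hu].
have -> : laplacian u = \big[(fun f g x => f x + g x)/(fun=> 0)]_i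
    partial_deriv i (partial_deriv i u).
  by apply/funext => y; rewrite /laplacian; elim/big_rec2: _ => //= i s f _ ->.
elim/big_rec: _ => [|i f _ IH]; first exact: class_C_cst.
by apply: class_C_add => //; have [_ [_ /(_ i) []]] := Hu i.
Qed.

Lemma class_C_iter_laplacian (R : realType) (N j k : nat) (u : 'rV[R]_N -> R) :
  class_C (2 * j + k) u -> class_C k (iter_laplacian j u).
Proof.
elim: j k => [|j IH] k //= Hu; apply: class_C_laplacian; apply: IH.
by have -> : (2 * j + k.+2 = 2 * j.+1 + k)%N by lia.
Qed.

Lemma laplacianZ (R : realType) (N : nat) (c : R) (u : 'rV[R]_N -> R) :
  class_C 2 u -> laplacian (fun x => c * u x) = fun x => c * laplacian u x.
Proof.
move=> [_ Hu]; apply/funext => x; rewrite /laplacian mulr_sumr; apply: eq_bigr => i _.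
have [du [_ /(_ i) [ddu _]]] := Hu i.
have E (f : 'rV[R]_N -> R) : (forall y, derivable f y (basis_vec R i)) ->
    partial_deriv i (fun y => c * f y) = fun y => c * partial_deriv i f y.
  by move=> df; apply/funext => y; exact: deriveMl.
by rewrite !E.
Qed.

Lemma iter_neg_laplacianE (R : realType) (N k : nat) (u : 'rV[R]_N -> R) :
  class_C (2 * k) u ->
  iter_neg_laplacian k u = fun x => (-1) ^+ k * iter_laplacian k u x.
Proof.
elim: k => [|k IH] Hu /=; first by apply/funext => x; rewrite mul1r.
have Hk : class_C (2 * k + 2) u by move: Hu; rewrite mulnS addnC.
rewrite /iter_neg_laplacian/= -/(iter_neg_laplacian k u) IH; last first.
  by apply: class_C_le Hk; rewrite leq_addr.
by apply/funext => x; rewrite laplacianZ ?exprS ?mulN1r ?mulNr//; exact: class_C_iter_laplacian.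
Qed.

Lemma nbhs_sqdist (R : realType) (N : nat) (a : 'rV[R]_N) (P : set 'rV[R]_N) :
  nbhs a P -> exists2 r : R, 0 < r & forall x, sqdist a x < r -> P x.
Proof.
move=> /nbhs_ballP[e /= e0 He]; exists (e ^+ 2) => [|x xe]; first exact: exprn_gt0.
apply: He; split=> // i j; rewrite (ord1 i) /ball/=.
rewrite -(ltr_pXn2r (isT : (0 < 2)%N)) ?nnegrE ?(ltW e0)//.
apply: le_lt_trans xe; rewrite distrC real_normK ?num_real//.
by rewrite /sqdist (bigD1 j)//= lerDl; apply: sumr_ge0 => k _; exact: sqr_ge0.
Qed.

(** The derivative in r is a positive multiple of the mean of the Laplacian, so the mean of v
    increases strictly, starting from the limit v a at r = 0. *)
Lemma mean_gt0 (R : realType) (N : nat) (a : 'rV[R]_N) p (v : 'rV[R]_N -> R) :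
  class_C 2 v -> 0 <= v a -> (forall r, 0 < r -> 0 < mean a p.+3 (laplacian v) r) ->
  forall r, 0 < r -> 0 < mean a p.+2 v r.
Proof.
move=> cv va Lv.
pose K : R := 4 * p.+3%:R + 2 * N%:R; have K0 : 0 < K by rewrite ltr_wpDr ?mulr_ge0 ?mulr_gt0.
have D (r : R) : 0 < r -> is_derive r 1 (mean a p.+2 v) (K^-1 * mean a p.+3 (laplacian v) r).
  exact: is_derive_mean.
have incr (r s : R) : 0 < r -> r < s -> mean a p.+2 v r < mean a p.+2 v s.
  move=> r0 rs; rewrite -subr_gt0.
  have [||c] := @MVT R (mean a p.+2 v) (fun r => K^-1 * mean a p.+3 (laplacian v) r) r s rs.
  - by move=> t; rewrite in_itv/= => /andP[rt _]; apply: D; exact: lt_trans rt.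
  - apply: derivable_within_continuous => t; rewrite in_itv/= => /andP[rt _].
    by apply: (@ex_derive _ _ _ _ _ _ _ (D t _)); exact: lt_le_trans rt.
  - rewrite in_itv/= => /andP[rc _] ->.
    by rewrite mulr_gt0 ?subr_gt0// mulr_gt0 ?invr_gt0// Lv// (lt_trans r0).
suff ge0 (r : R) : 0 < r -> 0 <= mean a p.+2 v r.
  move=> r r0; have h0 : 0 < r / 2 by rewrite divr_gt0.
  by apply: le_lt_trans (ge0 _ h0) (incr _ _ h0 _); lra.
move=> r0; apply/ler_addgt0Pr => e e0; rewrite -lerBlDr sub0r.
have : \forall x \near a, v a - e <= v x.
  by have /cvgrPdist_le /(_ _ e0) := cv.1 a; apply: filterS => x; rewrite ler_distlC => /andP[].
move=> /nbhs_sqdist[d d0 Hd].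
pose s := Num.min d (r / 2).
have s0 : 0 < s by rewrite lt_min d0 divr_gt0.
have sr : s < r by rewrite gt_min; apply/orP; right; lra.
apply: (le_trans _ (ltW (incr s r s0 sr))); apply: mean_ge => //; first exact: cv.1.
move=> x; rewrite lt_min => /andP[/Hd xd _]; lra.
Qed.

(** If the value were nonnegative at x0, the rescaled means of the iterated Laplacians about x0
    would satisfy the hypotheses of the blow-up lemma.  The factors c j make each function the
    derivative of the preceding one. *)
Lemma iter_laplacian_lt0 (R : realType) (N L : nat) (u : 'rV[R]_N -> R) (x0 : 'rV[R]_N) :
  (2 <= L)%N -> classical_solution L (@expR R) u -> iter_laplacian L.-1 u x0 < 0.
Proof.
move=> L2 [cu eu]; rewrite ltNge; apply/negP => ux0.
have cuu := class_C_continuous cu.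
have uL : iter_laplacian L u = fun x => expR (u x) by apply/funext.
have cj j : (j < L)%N -> class_C 2 (iter_laplacian j u).
  by move=> jL; apply: class_C_iter_laplacian; apply: class_C_le cu; lia.
pose K (j : nat) : R := (4 * j.+3%:R + 2 * N%:R)^-1.
have K0 j : 0 < K j by rewrite invr_gt0 ltr_wpDr ?mulr_ge0 ?mulr_gt0.
pose c j : R := \prod_(i < j) K i.
have c0 j : 0 < c j by apply: prodr_gt0.
pose A j r : R := c j * mean x0 j.+2 (iter_laplacian j u) r.
have ce : continuous (fun x => expR (u x)).
  by move=> x; exact: (continuous_comp (cuu x) (@continuous_expR R _)).
pose C := c L * 2 ^- (2 * 2 + N).
have LE : L = L.-1.+1 by lia.
apply: (@ode_blowup R L A C L2).
- move=> j r jL r0; have D := is_derive_mean x0 j (cj j jL) r0.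
  have := is_deriveZ (c j) D; rewrite /GRing.scale/= => {}D.
  apply: is_derive_eq; rewrite /A /c big_ord_recr/= -/(c j) -mulrA.
  by [].
- move=> r r0; rewrite mulr_gt0//; apply: mean_gt0 => //.
    by apply: cj; lia.
  move=> s s0; have -> : laplacian (iter_laplacian L.-1 u) = fun x => expR (u x).
    by rewrite -uL [in RHS]LE.
  exact: lt_le_trans (expR_gt0 _) (mean_jensen _ _ cuu s0).
- by rewrite mulr_gt0// invr_gt0 exprn_gt0.
- move=> s r s0 sr r2s; rewrite /A uL /c big_ord0 mul1r -/(c L) /C -2!mulrA.
  apply: ler_wpM2l; first exact: ltW.
  have := @mean_delay R N x0 0 L (fun x => expR (u x)) r s ce (fun x => expR_ge0 _) s0 sr r2s.
  rewrite addn0; apply: le_trans; rewrite mulrA.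
  apply: ler_wpM2l.
    by rewrite mulr_ge0 ?invr_ge0 ?exprn_ge0// divr_ge0 ?subr_ge0// ltW// (lt_le_trans s0).
  exact: mean_jensen.
Qed.

Theorem theorem1p1 (R : realType) (N m : nat) (hN : (1 <= N)%N)
    (hm : (1 <= m)%N) (u : 'rV[R]_N -> R)
    (hu : classical_solution (2 * m)%N (@expR R) u) :
  (forall x : 'rV[R]_N, iter_laplacian (2 * m - 1)%N u x < 0) /\
  (forall x : 'rV[R]_N, 0 < iter_neg_laplacian (2 * m - 1)%N u x).
Proof.
have lt0 x : iter_laplacian (2 * m - 1) u x < 0.
  by rewrite subn1; apply: iter_laplacian_lt0 => //; lia.
split=> // x; rewrite iter_neg_laplacianE; last by apply: class_C_le hu.1; lia.
have -> : (-1) ^+ (2 * m - 1) = -1 :> R.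
  have -> : (2 * m - 1 = (m.-1).*2.+1)%N by lia.
  by rewrite -signr_odd /= odd_double expr1.
by rewrite mulN1r oppr_gt0.
Qed.
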